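(* Let $\mathcal{B}$ be the set of Catalan words avoiding the pattern $(\geq,\geq)$ that do not end with two letters $ab$ satisfying $a\ge b$, and let \[ H(x,q)=\sum_{w\in\mathcal{B},\,w\ne\epsilon}x^{|w|}q^{\mathrm{inter}(w)}. \] Then \[ H(x,q)=\frac{\sum_{j\geq1}x^j\prod_{i=1}^{j-1}\left(q^{i-1}-\frac{1}{1-q^i}\right)} {1-\sum_{j\geq1}\frac{x^j}{1-q^j}\prod_{i=1}^{j-1}\left(q^{i-1}-\frac{1}{1-q^i}\right)}. \]
   Context: A Catalan word of length $n\ge 0$ is a sequence $w=w_1\cdots w_n$ of non-negative integers with $w_1=0$ and $0\le w_i\le w_{i-1}+1$ for $i=2,\dots,n$; $|w|$ is its length and $\epsilon$ the empty word. It avoids the pattern $(\geq,\geq)$ if there is no index $i$ with $w_i\ge w_{i+1}\ge w_{i+2}$. To $w$ is associated the polyomino $P(w)$ with $n$ bottom-aligned columns, the $i$-th column consisting of $w_i+1$ unit cells. $\mathrm{inter}(w)$ is the number of lattice points belonging to exactly four cells of $P(w)$. *)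

(* Defs.v *)
From HB Require Import structures.
From mathcomp Require Import all_boot all_order all_algebra.
From mathcomp Require Import boolp.

Set Implicit Arguments.
Unset Strict Implicit.
Unset Printing Implicit Defensive.

Import GRing.Theory.

(* Letters are indexed from 0: the letter w_i of the usual 1-based notation   *)
(* is [nth 0 w i.-1].                                                         *)

Local Open Scope nat_scope.

Definition catalan (w : seq nat) : bool :=
  (head 0 w == 0) && sorted (fun a b => b <= a.+1) w.

Definition avoids_geq_geq (w : seq nat) : bool :=
  [forall i : 'I_(size w), (i.+2 < size w) ==>
     ~~ ((nth 0 w i >= nth 0 w i.+1) && (nth 0 w i.+1 >= nth 0 w i.+2))].

Definition ends_geq (w : seq nat) : bool :=
  (1 < size w) && (nth 0 w (size w).-2 >= nth 0 w (size w).-1).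

Definition inB (w : seq nat) : bool :=
  [&& catalan w, avoids_geq_geq w & ~~ ends_geq w].

(* A unit cell is named by its lower left corner.  The polyomino sits in the  *)
(* first quadrant, so natural number coordinates cover all lattice points     *)
(* that belong to some cell; those of a unit cell are its four corners.       *)

Definition cells (w : seq nat) : seq (nat * nat) :=
  [seq (i, j) | i <- iota 0 (size w), j <- iota 0 (nth 0 w i).+1].

Definition corners (c : nat * nat) : seq (nat * nat) :=
  [:: (c.1, c.2); (c.1.+1, c.2); (c.1, c.2.+1); (c.1.+1, c.2.+1)].

Definition lattice_points (w : seq nat) : seq (nat * nat) :=
  undup (flatten [seq corners c | c <- cells w]).

Definition inter (w : seq nat) : nat :=
  count (fun p => count (fun c => p \in corners c) (cells w) == 4)
        (lattice_points w).

(* Letters of a Catalan word are smaller than its length, hence the tuples    *)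
(* of type [n.-tuple 'I_n] range over all Catalan words of length n.          *)
Lemma catalan_lt_size (w : seq nat) :
  catalan w -> all (fun a => a < size w) w.
Proof.
case: w => [//|a s] /andP[/= /eqP -> {a}] pth.
have H b m : path (fun a b => b <= a.+1) b s -> b <= m ->
    all (fun a => a <= m + size s) s.
  elim: s b m {pth} => [//|c s IHs] b m /= /andP[cb pcs] bm.
  have cm : c <= m.+1 by rewrite (leq_trans cb).
  rewrite addnS -addSn (leq_trans cm (leq_addr _ _)) /=.
  exact: IHs pcs cm.
exact: H pth (leqnn 0).
Qed.

Local Open Scope ring_scope.

(* Formal power series in one variable x; [Fps c] is the sum of the c_n x^n.  *)
Record fps (R : Type) := Fps { coef_fps :> nat -> R }.

Lemma fpsP (R : Type) (f g : fps R) : (forall n, f n = g n) <-> f = g.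
Proof.
split=> [|-> //]; case: f g => [f] [g] /= fg; congr Fps; exact: funext.
Qed.

HB.instance Definition _ (R : Type) := gen_eqMixin (fps R).
HB.instance Definition _ (R : Type) := gen_choiceMixin (fps R).

Section FpsZmod.
Variable R : zmodType.
Implicit Types f g h : fps R.

Definition fps_zero : fps R := Fps (fun=> 0).
Definition fps_opp f : fps R := Fps (fun n => - f n).
Definition fps_add f g : fps R := Fps (fun n => f n + g n).

Fact fps_addA : associative fps_add.
Proof. by move=> f g h; apply/fpsP=> n /=; rewrite addrA. Qed.
Fact fps_addC : commutative fps_add.
Proof. by move=> f g; apply/fpsP=> n /=; rewrite addrC. Qed.
Fact fps_add0 : left_id fps_zero fps_add.
Proof. by move=> f; apply/fpsP=> n /=; rewrite add0r. Qed.
Fact fps_addN : left_inverse fps_zero fps_opp fps_add.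
Proof. by move=> f; apply/fpsP=> n /=; rewrite addNr. Qed.

HB.instance Definition _ :=
  GRing.isZmodule.Build (fps R) fps_addA fps_addC fps_add0 fps_addN.
End FpsZmod.

Section FpsRing.
Variable R : comNzRingType.
Implicit Types f g h : fps R.

Definition fps_one : fps R := Fps (fun n => (n == 0%N)%:R).
Definition fps_mul f g : fps R :=
  Fps (fun n => \sum_(i < n.+1) f i * g (n - i)%N).

Let trunc N f : {poly R} := \poly_(i < N.+1) f i.

Let coef_trunc N f i : (i <= N)%N -> (trunc N f)`_i = f i.
Proof. by rewrite coef_poly ltnS => ->. Qed.

Let coef_fps_mul N f g n : (n <= N)%N ->
  fps_mul f g n = (trunc N f * trunc N g)`_n.
Proof.
move=> nN; rewrite coefM; apply: eq_bigr => i _.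
rewrite !coef_trunc ?(leq_trans (leq_subr _ _)) //.
by rewrite (leq_trans _ nN) // -ltnS.
Qed.

Fact fps_mulA : associative fps_mul.
Proof.
move=> f g h; apply/fpsP=> n.
transitivity ((trunc n f * (trunc n g * trunc n h))`_n).
  rewrite coefM; apply: eq_bigr => i _.
  by rewrite coef_trunc -1?ltnS // (@coef_fps_mul n) // leq_subr.
rewrite mulrA coefM; apply: eq_bigr => i _.
by rewrite coef_trunc ?leq_subr // (@coef_fps_mul n) // -ltnS.
Qed.

Fact fps_mulC : commutative fps_mul.
Proof.
by move=> f g; apply/fpsP=> n; rewrite !(@coef_fps_mul n) // mulrC.
Qed.

Fact fps_mul1 : left_id fps_one fps_mul.
Proof.
move=> f; apply/fpsP=> n /=.
rewrite big_ord_recl /= mul1r subn0 big1 ?addr0 // => i _.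
by rewrite mul0r.
Qed.

Fact fps_mulDl : left_distributive fps_mul (@fps_add R).
Proof.
move=> f g h; apply/fpsP=> n /=.
by rewrite -big_split; apply: eq_bigr => i _; rewrite mulrDl.
Qed.

Fact fps_one_neq0 : fps_one != 0.
Proof.
by apply/eqP=> /fpsP /(_ 0%N) /eqP; rewrite oner_eq0.
Qed.

HB.instance Definition _ := GRing.Zmodule_isComNzRing.Build (fps R)
  fps_mulA fps_mulC fps_mul1 fps_mulDl fps_one_neq0.
End FpsRing.

Lemma coef_fpsM (R : comNzRingType) (f g : fps R) n :
  (f * g) n = \sum_(i < n.+1) f i * g (n - i)%N.
Proof. by []. Qed.

Section FpsUnitRing.
Variable R : comUnitRingType.
Implicit Types f g : fps R.

Definition fps_unit : pred (fps R) := fun f => f 0%N \is a GRing.unit.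

(* The first n coefficients of the inverse g of f, obtained by solving        *)
(* f_0 g_m + \sum_(i < m) f_(m - i) g_i = [m = 0] for g_m.                    *)
Fixpoint fps_inv_prefix f n : seq R :=
  if n is m.+1 then
    let s := fps_inv_prefix f m in
    rcons s ((f 0%N)^-1 * ((m == 0%N)%:R - \sum_(i < m) f (m - i)%N * s`_i))
  else [::].

Definition fps_inv f : fps R :=
  if fps_unit f then Fps (fun n => (fps_inv_prefix f n.+1)`_n) else f.

Let size_prefix f n : size (fps_inv_prefix f n) = n.
Proof. by elim: n => //= n IHn; rewrite size_rcons IHn. Qed.

Let nth_prefix f n i : (i < n)%N ->
  (fps_inv_prefix f n)`_i = (fps_inv_prefix f i.+1)`_i.
Proof.
elim: n => // n IHn; rewrite ltnS leq_eqVlt => /orP[/eqP -> //|lt_in].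
by rewrite [LHS]/= nth_rcons size_prefix lt_in IHn.
Qed.

Fact fps_mulVr : {in fps_unit, left_inverse 1 fps_inv *%R}.
Proof.
move=> f uf; rewrite mulrC; apply/fpsP=> n; rewrite coef_fpsM.
have {}uf : fps_unit f by [].
rewrite /fps_inv uf (reindex_inj rev_ord_inj) /= big_ord_recr /= subnn subn0.
rewrite nth_rcons size_prefix ltnn eqxx mulVKr //.
under eq_bigr => i _ do
  rewrite !subSS (subKn (ltnW (ltn_ord i))) -/(fps_inv_prefix f i.+1).
rewrite (eq_bigr (fun i : 'I_n => f (n - i)%N * (fps_inv_prefix f n)`_i)).
  by rewrite addrC subrK.
by move=> i _; rewrite nth_prefix.
Qed.

Fact fps_unitPl f g : g * f = 1 -> fps_unit f.
Proof.
move=> /fpsP /(_ 0%N); rewrite coef_fpsM big_ord1 /= => gf1.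
by apply/unitrPr; exists (g 0%N); rewrite mulrC.
Qed.

Fact fps_inv_out : {in [predC fps_unit], fps_inv =1 id}.
Proof. by move=> f; rewrite inE /= /fps_inv => /negbTE; rewrite /in_mem /= => ->. Qed.

HB.instance Definition _ := GRing.ComNzRing_hasMulInverse.Build (fps R)
  fps_mulVr fps_unitPl fps_inv_out.
End FpsUnitRing.

Lemma fps_unitE (R : comUnitRingType) (f : fps R) :
  (f \is a GRing.unit) = (f 0%N \is a GRing.unit).
Proof. by []. Qed.

(* The series \sum_(j >= 1) c_j x^j. *)
Definition fps_sum_ge1 (R : nmodType) (c : nat -> R) : fps R :=
  Fps (fun j => if (1 <= j)%N then c j else 0).

Lemma fps_unit_sub_sum_ge1 (R : comUnitRingType) (c : nat -> R) :
  1 - fps_sum_ge1 c \is a GRing.unit.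
Proof. by rewrite fps_unitE /= subr0 unitr1. Qed.

Definition Hgf (R : nzRingType) (q : R) : fps R :=
  Fps (fun n => \sum_(t : n.-tuple 'I_n |
                       inB (map val t) && (map val t != [::]))
                  q ^+ inter (map val t)).

(* Main.v *)
(* Cutting a nonempty w in B at its last 0 gives w = s 0 (v+1) with s and v in B,
   and v nonempty unless s is empty; then
   inter(w) = inter(s) + inter(v) + max(|v| - 1, 0).
   Hence A = 1 + H satisfies the q-Riccati equation
     q A(x) = q (1 + x) + x A(x) (A(qx) - 1),
   which determines A coefficient by coefficient.  Let N and D be the numerator
   and the denominator of the claimed quotient.  Their definitions give
   D(qx) = D(x) + N(x) and q N(x) = q x D(x) + x N(qx), so D(qx)/D(x) = 1 + N/D
   solves the same equation. *)
Require Import Defs.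
From HB Require Import structures.
From mathcomp Require Import all_boot all_order all_algebra.
From mathcomp Require Import zify ring.
Import GRing.Theory.

Set Implicit Arguments.
Unset Strict Implicit.
Unset Printing Implicit Defensive.

(** * A local recursive test for membership in B *)

(* A letter may drop (weakly) only if it is then followed by a rise.  Past the
   end, [head 0 t] is 0, which is never [b.+1]: final weak descents are excluded. *)
Fixpoint good (w : seq nat) : bool :=
  if w is a :: s then
    if s is b :: t then
      [&& b <= a.+1, (b == a.+1) || (head 0 t == b.+1) & good s]
    else true
  else true.

Lemma good_map_succn w : good (map succn w) = good w.
Proof.
elim: w => // a [//|b t] /= ->; rewrite ltnS eqSS; case: t => //= c t.
Qed.

(** The inserted 0 is no rise, so to the last letters of [s] it looks like the end of the word.
    After a nonempty [s] it is itself a weak descent and needs a 1 behind it. *)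
Lemma good_cat_zero s t :
  good (s ++ 0 :: t) = [&& good s, (s == [::]) || (head 0 t == 1) & good (0 :: t)].
Proof.
elim: s => // a [|b s] IHs; first by case: t {IHs}.
have -> : good ((a :: b :: s) ++ 0 :: t) =
    [&& b <= a.+1, (b == a.+1) || (head 0 (s ++ 0 :: t) == b.+1)
      & good ((b :: s) ++ 0 :: t)] by [].
by rewrite IHs /= -!andbA; case: s {IHs}.
Qed.

Lemma good_zero_map_succn v :
  good (0 :: map succn v) = (head 0 v == 0) && good v.
Proof.
by rewrite -[good v]good_map_succn; case: v => //= -[].
Qed.

Lemma good_nthP w :
  reflect (forall i, i.+1 < size w ->
             nth 0 w i.+1 <= (nth 0 w i).+1 /\
             (nth 0 w i.+1 = (nth 0 w i).+1 \/ nth 0 w i.+2 = (nth 0 w i.+1).+1))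
          (good w).
Proof.
elim: w => [|a [|b t] IHw]; [by left|by left|].
apply: (iffP and3P) => [[ba bt /IHw gt] [_|i lti]|gw].
- split=> //=; rewrite nth0.
  by case/orP: bt => /eqP; [left|right].
- exact: gt.
- have [/= ba bt] := gw 0 isT.
  split=> //; first by rewrite -nth0; apply/orP; case: bt => /eqP; [left|right].
  by apply/IHw => i; apply: gw i.+1.
Qed.

(** Reading 0 past the end merges two conditions: inside the word, a descent without a later rise is
    the pattern; at the last pair no rise can follow, so the descent itself is excluded. *)
Lemma inB_good w : inB w = (head 0 w == 0) && good w.
Proof.
rewrite /inB /catalan -andbA; congr (_ && _).
apply/and3P/good_nthP => [[/(sortedP 0) cw /forallP aw ew] i lti|gw].
  split; first exact: cw.
  have [lt2|ge2] := ltnP i.+2 (size w).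
    have := implyP (aw (Ordinal (ltnW lti))) lt2.
    have := cw _ lti; have := cw _ lt2; rewrite /=; lia.
  have sw : size w = i.+2 by lia.
  move: ew (cw _ lti); rewrite /ends_geq sw /=; lia.
split.
- by apply/(sortedP 0) => i /gw[].
- apply/forallP => i; apply/implyP => lti.
  have [_] := gw i (ltnW lti); lia.
- rewrite /ends_geq; apply/negP => /andP[lt1 ge].
  have [] := gw (size w).-2 ltac:(lia).
  move: ge; rewrite (_ : (size w).-2.+1 = (size w).-1); last lia.
  rewrite [nth 0 w _.+1]nth_default; lia.
Qed.

(** * Cutting a word at its last 0 *)

Definition glue (s v : seq nat) : seq nat := s ++ 0 :: map succn v.

Lemma inB_glue s v :
  inB (glue s v) = [&& inB s, inB v & (s == [::]) || (v != [::])].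
Proof.
rewrite /glue !inB_good good_cat_zero good_zero_map_succn.
case: s => [|a s]; case: v => [|b v]; rewrite /= ?andbT ?andbF //.
by rewrite eqSS; case: (b == 0); rewrite ?andbF -?andbA.
Qed.

(** The last 0 is the first 0 of the reversed word, and its index there is [size v]. *)
Lemma glue_inj s v s' v' : glue s v = glue s' v' -> (s, v) = (s', v').
Proof.
have rev_glue u t : rev (glue u t) = map succn (rev t) ++ 0 :: rev u.
  by rewrite rev_cat rev_cons -map_rev -cats1 -catA.
move/(congr1 rev); rewrite !rev_glue => e.
have: size v = size v'.
  have index_glue u t : index 0 (map succn (rev t) ++ 0 :: rev u) = size t.
    rewrite index_cat; case: ifP => [/mapP[] //|_].
    by rewrite /= addn0 size_map size_rev.
  by move/(congr1 (index 0)): e; rewrite !index_glue.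
move=> sz; move/eqP: e; rewrite eqseq_cat ?size_map ?size_rev //.
case/andP=> /eqP ev /eqP[es].
congr pair; apply: (can_inj (@revK nat)) => //.
exact: inj_map succn_inj _ _ ev.
Qed.

(** Induction from the right: a final 0 is the cut itself, with [v] empty; a final [a.+1] appends
    [a] to the [v] of the shorter word. *)
Lemma ex_glue w : head 0 w = 0 -> w != [::] -> exists s v, w = glue s v.
Proof.
elim/last_ind: w => // w a IHw hw _.
case: a hw => [|a] hw; first by exists w, [::]; rewrite /glue cats1.
case: w IHw hw => // b w IHw hw.
have [//|//|s [v ->]] := IHw.
by exists s, (rcons v a); rewrite /glue map_rcons rcons_cat.
Qed.

(** * Interior lattice points as minima of adjacent letters *)

Lemma mem_cells w x y : ((x, y) \in cells w) = (x < size w) && (y <= nth 0 w x).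
Proof.
apply/allpairsPdep/andP => [[i [j [+ + [-> ->]]]]|[ltx ley]].
  by rewrite !mem_iota !add0n ltnS.
by exists x, y; rewrite !mem_iota !add0n ltnS.
Qed.

Lemma uniq_cells w : uniq (cells w).
Proof.
apply: allpairs_uniq_dep => [|i _|]; rewrite ?iota_uniq //.
by move=> [i j] [i' j'] _ _ /= [-> ->].
Qed.

(** No cell has a negative coordinate, so a point on an axis touches at most two cells. *)
Definition cells_around (p : nat * nat) : seq (nat * nat) :=
  match p with
  | (0, 0) => [:: (0, 0)]
  | (0, y.+1) => [:: (0, y); (0, y.+1)]
  | (x.+1, 0) => [:: (x, 0); (x.+1, 0)]
  | (x.+1, y.+1) => [:: (x, y); (x.+1, y); (x, y.+1); (x.+1, y.+1)]
  end.

Lemma mem_cells_around p c : (c \in cells_around p) = (p \in corners c).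
Proof.
case: p c => [[|x] [|y]] [i j]; rewrite !inE /= !xpair_eqE; lia.
Qed.

Lemma uniq_cells_around p : uniq (cells_around p).
Proof. by case: p => [[|x] [|y]]; rewrite //= !inE !xpair_eqE; lia. Qed.

(** Double counting: look at the cells around the point that lie in the polyomino. All four do as
    soon as the two upper ones do. *)
Lemma four_cells w x y :
  (count (fun c => (x, y) \in corners c) (cells w) == 4) =
  [&& 0 < x, 0 < y, x < size w, y <= nth 0 w x.-1 & y <= nth 0 w x].
Proof.
have -> : count (fun c => (x, y) \in corners c) (cells w) =
          count (mem (cells w)) (cells_around (x, y)).
  rewrite -!size_filter; apply/perm_size/uniq_perm.
  - exact/filter_uniq/uniq_cells.
  - exact/filter_uniq/uniq_cells_around.
  - by move=> c; rewrite !mem_filter mem_cells_around andbC.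
case: x y => [|x] [|y]; rewrite /= ?mem_cells; lia.
Qed.

Fixpoint minsum (w : seq nat) : nat :=
  if w is a :: s then (if s is b :: _ then minn a b else 0) + minsum s else 0.

Lemma minsum_nth w :
  minsum w = sumn [seq minn (nth 0 w i) (nth 0 w i.+1) | i <- iota 0 (size w).-1].
Proof.
elim: w => // a [//|b t] /= ->.
by rewrite (iotaDl 1 0) -map_comp.
Qed.

(** On the line between two adjacent columns, the interior points have heights 1 up to the smaller
    letter. *)
Lemma inter_minsum w : inter w = minsum w.
Proof.
pose pts := [seq (i.+1, j) | i <- iota 0 (size w).-1,
                             j <- iota 1 (minn (nth 0 w i) (nth 0 w i.+1))].
have -> : minsum w = size pts.
  rewrite size_allpairs_dep minsum_nth; congr sumn.
  by apply: eq_map => i; rewrite size_iota.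
rewrite /inter -size_filter; apply/perm_size/uniq_perm.
- exact/filter_uniq/undup_uniq.
- apply: allpairs_uniq_dep => [|i _|]; rewrite ?iota_uniq //.
  by move=> [i j] [i' j'] _ _ /= [-> ->].
move=> [x y]; rewrite mem_filter four_cells mem_undup.
apply/andP/allpairsPdep => [[bxy _]|[i [j [+ + [-> ->]]]]].
  exists x.-1, y; rewrite !mem_iota prednK; last lia.
  split=> //; lia.
rewrite !mem_iota => lti ltj; split; first by rewrite /=; lia.
apply/flatten_mapP; exists (i.+1, j); last by rewrite !inE eqxx.
by rewrite mem_cells; lia.
Qed.

Lemma minsum_map_succn v : minsum (map succn v) = minsum v + (size v).-1.
Proof. by elim: v => // a [|b t] //= ->; lia. Qed.

Lemma minsum_cat_zero s t : minsum (s ++ 0 :: t) = minsum s + minsum t.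
Proof.
elim: s => [|a s /= ->]; first by case: t => //= *; rewrite min0n.
by case: s => [|b s] /=; rewrite ?minn0 ?addnA.
Qed.

(** Pairs containing the inserted 0 contribute nothing; raising [v] by one adds 1 for each adjacent
    pair in [v]. *)
Lemma inter_glue s v : inter (glue s v) = inter s + inter v + (size v).-1.
Proof.
by rewrite !inter_minsum /glue minsum_cat_zero minsum_map_succn addnA.
Qed.

(** * Enumeration by length and the bijection with pairs *)

Definition words n : seq (seq nat) :=
  [seq map val t | t : n.-tuple 'I_n <- enum {: n.-tuple 'I_n}
                 & inB (map val t)].

Lemma uniq_words n : uniq (words n).
Proof.
rewrite map_inj_uniq; first exact/filter_uniq/enum_uniq.
by move=> t u /(inj_map val_inj)/val_inj.
Qed.

Lemma mem_words n w : (w \in words n) = (size w == n) && inB w.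
Proof.
apply/mapP/andP => [[t + ->]|[/eqP sw Bw]].
  by rewrite mem_filter size_map size_tuple eqxx => /andP[].
have /allP ltw := catalan_lt_size (proj1 (andP Bw)).
have ew : map val (pmap (insub : nat -> option 'I_n) w) = w.
  rewrite pmap_filter; last by move=> i; rewrite insubK.
  by apply/all_filterP/allP => i /ltw; rewrite sw isSome_insub.
have st : size (pmap (insub : nat -> option 'I_n) w) == n.
  by rewrite -(size_map val) ew sw.
exists (Tuple st); last by rewrite [RHS]ew.
by rewrite mem_filter mem_enum [map val _]ew Bw.
Qed.

Definition word_pairs n : seq (seq nat * seq nat) :=
  [seq p | i <- iota 0 n, p <- [seq (s, v) | s <- words i, v <- words (n - i)]].

Lemma mem_word_pairs n s v :
  ((s, v) \in word_pairs n) =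
  [&& inB s, inB v, size s + size v == n & 0 < size v].
Proof.
apply/allpairsPdep/and4P => [[i [p [+ + ep]]]|[Bs Bv sz v0]].
  rewrite -{p}ep mem_iota => lti /allpairsP[[s' v'] /= [+ + [es ev]]].
  rewrite -{}es -{}ev !mem_words => /andP[/eqP zs ->] /andP[/eqP zv ->].
  by split=> //; rewrite ?zs zv; lia.
exists (size s), (s, v); split=> //; first by rewrite mem_iota; lia.
apply/allpairsP; exists (s, v); rewrite !mem_words Bs Bv eqxx /=; split=> //.
by rewrite -(eqP sz) addKn eqxx.
Qed.

Lemma uniq_word_pairs n : uniq (word_pairs n).
Proof.
apply: allpairs_uniq_dep => [|i _|]; rewrite ?iota_uniq //.
  by apply: allpairs_uniq; rewrite ?uniq_words // => -[? ?] [? ?].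
set pairs := flatten _ => /=.
(* The index [i] is recovered from the pair as the length of its first word. *)
have tag_size : {in pairs, forall u, tag u = size (tagged u).1}.
  move=> _ /allpairsPdep[i [p [_ + ->]]] /= => /allpairsP[[s v] [+ _ ->]] /=.
  by rewrite mem_words => /andP[/eqP].
move=> u v /tag_size + /tag_size.
by case: u v => [i p] [j p'] /= -> -> ->.
Qed.

(** From length 2 on [v] is nonempty, since an empty [v] forces an empty [s], hence the word 0. *)
Lemma words_glue n :
  perm_eq (words n.+2) [seq glue p.1 p.2 | p <- word_pairs n.+1].
Proof.
apply: uniq_perm; first exact: uniq_words.
  rewrite map_inj_uniq ?uniq_word_pairs //.
  by move=> [s v] [s' v'] /glue_inj.
move=> w; rewrite mem_words; apply/andP/mapP => [[/eqP sw Bw]|[[s v] + ->]].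
  have w0 : w != [::] by case: (w) sw.
  have /andP[/eqP hw _] : (head 0 w == 0) && good w by rewrite -inB_good.
  have [s [v ew]] := ex_glue hw w0.
  exists (s, v) => //; rewrite mem_word_pairs.
  move: sw Bw; rewrite ew inB_glue size_cat /= size_map.
  rewrite -!size_eq0 => szw /and3P[-> -> nz] /=.
  by move: (size s) (size v) szw nz => a b; lia.
rewrite mem_word_pairs inB_glue size_cat /= size_map -!size_eq0.
move=> /and4P[-> -> szw nz] /=; lia.
Qed.

(** * The q-Riccati equation and its unique solution *)

Local Open Scope ring_scope.

Section CatalanSeries.
Variables (F : fieldType) (q : F).
Implicit Types f g : fps F.

Lemma sum_words_rec n :
  \sum_(w <- words n.+2) q ^+ inter w =
  \sum_(i < n.+1) (\sum_(w <- words i) q ^+ inter w) *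
    (q ^+ (n - i) * \sum_(w <- words (n.+1 - i)) q ^+ inter w).
Proof.
rewrite (perm_big _ (words_glue n)) big_map big_allpairs_dep.
rewrite -[iota _ _]/(index_iota 0 n.+1) big_mkord.
apply: eq_bigr => i _; rewrite big_allpairs big_distrl /=.
rewrite [LHS]big_seq_cond [RHS]big_seq_cond; apply: eq_bigr => s _.
rewrite !big_distrr /= [LHS]big_seq_cond [RHS]big_seq_cond; apply: eq_bigr => v.
rewrite andbT mem_words => /andP[/eqP sv _].
rewrite inter_glue sv !exprD; have -> : ((n.+1 - i).-1 = n - i)%N by lia.
by ring.
Qed.

Lemma words0 : words 0 = [:: [::]].
Proof.
apply: perm_small_eq => //; apply: uniq_perm => //; first exact: uniq_words.
move=> w; rewrite mem_words inE size_eq0 inB_good.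
by case: eqP => // ->.
Qed.

Lemma words1 : words 1 = [:: [:: 0%N]].
Proof.
apply: perm_small_eq => //; apply: uniq_perm => //; first exact: uniq_words.
move=> w; rewrite mem_words inE inB_good.
by case: w => [|a [|b t]] //=; rewrite eqseq_cons ?andbF ?andbT.
Qed.

Lemma coef_Hgf n : (1 + Hgf q) n = \sum_(w <- words n) q ^+ inter w.
Proof.
rewrite -[LHS]/((n == 0%N)%:R + Hgf q n) [Hgf q n]/=.
case: n => [|n].
  rewrite words0 big_seq1 big1 ?addr0 //= => t.
  by rewrite tuple0 andbF.
rewrite add0r big_map big_filter big_enum_cond /=; apply: eq_bigl => t.
by rewrite -size_eq0 size_map size_tuple andbT.
Qed.

(** The substitution f(qx). *)
Definition fps_scale f : fps F := Fps (fun n => q ^+ n * f n).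
Definition fps_const (c : F) : fps F := Fps (fun n => c *+ (n == 0)%N).
Definition fps_X : fps F := Fps (fun n => (n == 1)%N%:R).

Lemma coef_fps_constM c f n : (fps_const c * f) n = c * f n.
Proof.
rewrite coef_fpsM big_ord_recl big1 ?addr0 /= ?subn0 // => i _.
by rewrite mul0r.
Qed.

Lemma coef_fps_XM f n : (fps_X * f) n = if n is m.+1 then f m else 0.
Proof.
rewrite coef_fpsM big_ord_recl /= mul0r add0r.
case: n => [|n]; first by rewrite big_ord0.
rewrite big_ord_recl big1 /= ?mul1r ?addr0 ?subSS ?subn0 // => i _.
by rewrite mul0r.
Qed.

Lemma fps_scaleM f g : fps_scale (f * g) = fps_scale f * fps_scale g.
Proof.
apply/fpsP => n; rewrite [LHS]/= !coef_fpsM big_distrr; apply: eq_bigr => i _ /=.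
by rewrite mulrACA -exprD subnKC // -ltnS.
Qed.

Lemma fps_scaleD f g : fps_scale (f + g) = fps_scale f + fps_scale g.
Proof. by apply/fpsP => n /=; rewrite mulrDr. Qed.

Definition riccati f : Prop :=
  fps_const q * f = fps_const q * (1 + fps_X) + fps_X * (f * (fps_scale f - 1)).

(** The factor [fps_X] makes each coefficient on the right depend only on lower ones, and q can be
    cancelled on the left. *)
Lemma riccati_uniq f g : q != 0 -> riccati f -> riccati g -> f = g.
Proof.
move=> q0 rf rg; apply/fpsP => n; elim/ltn_ind: n => n IHn.
apply: (mulfI q0); rewrite -!coef_fps_constM rf rg.
rewrite -[LHS]/(_ + _) -[RHS]/(_ + _); congr (_ + _).
rewrite !coef_fps_XM; case: n IHn => // n IHn.
rewrite !coef_fpsM; apply: eq_bigr => i _.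
by rewrite /= !IHn // ?ltnS ?leq_subr // -ltnS.
Qed.

(** The overall factor q turns the weight q^(|v|-1) of the recurrence into the q^|v| produced by the
    substitution. *)
Lemma riccati_Hgf : riccati (1 + Hgf q).
Proof.
apply/fpsP => n; rewrite -[RHS]/(_ + _) !coef_fps_constM coef_fps_XM.
have coefX m : (1 + fps_X) m = (m == 0%N)%:R + (m == 1%N)%:R by [].
have coefB m : (fps_scale (1 + Hgf q) - 1) m =
    q ^+ m * (\sum_(w <- words m) q ^+ inter w) - (m == 0%N)%:R.
  by rewrite -coef_Hgf.
rewrite coefX coef_Hgf; case: n => [|[|n]].
- by rewrite words0 big_seq1 /= !addr0.
- rewrite coef_fpsM big_ord1 coef_Hgf coefB words0 words1 !big_seq1.
  by rewrite !inter_minsum /= subnn; ring.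
- have -> : q * ((n.+2 == 0%N)%:R + (n.+2 == 1%N)%:R) = 0.
    by rewrite addr0 mulr0.
  (* The last term of the convolution, with [v] empty, vanishes: A(qx) - 1 has no constant term. *)
  rewrite add0r coef_fpsM big_ord_recr subnn coefB words0 big_seq1 inter_minsum.
  rewrite eqxx !expr0 mulr1 subrr mulr0 [RHS]addr0 sum_words_rec big_distrr.
  apply: eq_bigr => i _; rewrite coef_Hgf coefB.
  rewrite !subSn -1?ltnS ?ltn_ord // subr0 exprS /=.
  by ring.
Qed.

(** * Numerator and denominator of the quotient *)

Definition numer_coef j := \prod_(1 <= i < j) (q ^+ (i - 1) - 1 / (1 - q ^+ i)).
Definition numer := fps_sum_ge1 numer_coef.
Definition denom := 1 - fps_sum_ge1 (fun j => 1 / (1 - q ^+ j) * numer_coef j).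

Hypothesis q_nonroot : forall n, (0 < n)%N -> 1 - q ^+ n != 0.

(** With c_n for [numer_coef n], in degree n >= 1: (q^n - 1) * (-c_n / (1 - q^n)) = c_n. *)
Lemma fps_scale_denom : fps_scale denom = denom + numer.
Proof.
apply/fpsP => -[|n]; first by rewrite /= subr0 mul1r addr0.
rewrite -[RHS]/(denom n.+1 + numer n.+1) /= !sub0r.
by move: (q_nonroot (ltn0Sn n)); set u := q ^+ n.+1 => u1; field.
Qed.

(** For n >= 1, q c_(n+1) = q^n c_n - q c_n / (1 - q^n): the first term comes from x N(qx), the
    second from q x D(x). *)
Lemma fps_scale_numer :
  fps_const q * numer = fps_const q * (fps_X * denom) + fps_X * fps_scale numer.
Proof.
apply/fpsP => n; rewrite -[RHS]/(_ + _) !coef_fps_constM !coef_fps_XM.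
case: n => [|[|n]]; first by rewrite mulr0 addr0.
  by rewrite /= /numer_coef big_geq // subr0 mulr0 addr0.
rewrite /= sub0r /numer_coef big_nat_recr //= subn1 /= [q ^+ n.+1 in RHS]exprS.
by move: (q_nonroot (ltn0Sn n)); rewrite exprS => qn; field.
Qed.

Lemma riccati_quotient : riccati (fps_scale denom / denom).
Proof.
have denomU : denom \is a GRing.unit by exact: fps_unit_sub_sum_ge1.
have sdenomU : fps_scale denom \is a GRing.unit.
  by rewrite fps_unitE /= subr0 mulr1 unitr1.
have scaleV : fps_scale (fps_scale denom / denom) =
    (fps_scale denom + fps_scale numer) / fps_scale denom.
  apply: (mulIr sdenomU); rewrite -fps_scaleM !divrK //.
  by rewrite [in LHS]fps_scale_denom fps_scaleD.
apply: (mulIr denomU); rewrite mulrA divrK // scaleV.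
(* D(qx) cancels in A(x) (A(qx) - 1), which leaves an equation linear in D and N. *)
have -> : fps_scale denom / denom *
    ((fps_scale denom + fps_scale numer) / fps_scale denom - 1) =
    fps_scale numer / denom.
  set D := fps_scale denom; set N := fps_scale numer.
  have -> : D / denom * ((D + N) / D - 1) =
      (D / D) * ((D + N) / denom) - D / denom by ring.
  by rewrite divrr //; ring.
rewrite mulrDl [fps_X * _]mulrA divrK //.
by rewrite fps_scale_denom mulrDr fps_scale_numer; ring.
Qed.

Lemma Hgf_quotient : q != 0 -> Hgf q = numer / denom.
Proof.
move=> q0; have denomU : denom \is a GRing.unit by exact: fps_unit_sub_sum_ge1.
have /(canRL (addKr _)) -> := riccati_uniq q0 riccati_Hgf riccati_quotient.
by rewrite fps_scale_denom mulrDl divrr // addKr.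
Qed.

End CatalanSeries.

Theorem theorem5p2 :
  let q : {fraction {poly rat}} := tofrac 'X in
  Hgf q =
    fps_sum_ge1
      (fun j => \prod_(1 <= i < j) (q ^+ (i - 1) - 1 / (1 - q ^+ i)))
    / (1 - fps_sum_ge1
             (fun j => 1 / (1 - q ^+ j) *
                \prod_(1 <= i < j) (q ^+ (i - 1) - 1 / (1 - q ^+ i)))).
Proof.
move=> q; apply: Hgf_quotient => [[|n] // _|]; last first.
  by rewrite /q tofrac_eq0 polyX_eq0.
(* As q is the indeterminate, it suffices that X^n - 1 is a nonzero polynomial for n >= 1. *)
rewrite subr_eq0 eq_sym /q -tofracXn -tofrac1 tofrac_eq -subr_eq0.
by rewrite -size_poly_eq0 size_XnsubC.
Qed.
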